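(* Let $\mathfrak{H}$ and $\mathfrak{K}_n$, $n\in\mathbb{N}$, be Hilbert spaces, let $T_n\in\mathbf{L}(\mathfrak{H},\mathfrak{K}_n)$ be a sequence of linear operators with $T_m\prec_c T_n$ for $m\le n$, and assume that $T_n$ is closable for every $n\in\mathbb{N}$. Let $T\in\mathbf{L}(\mathfrak{H},\mathfrak{K})$, where $\mathfrak{K}$ is a Hilbert space, be the closable limit of $T_n$, i.e. a closable linear operator with $\operatorname{dom} T=\{\varphi\in\bigcap_{n}\operatorname{dom}T_n:\sup_{n}\|T_n\varphi\|<\infty\}$, $T_n\prec_c T$ for all $n$, and $\|T_n\varphi\|\nearrow\|T\varphi\|$ for all $\varphi\in\operatorname{dom}T$. Then the closures $T_n^{**}\in\mathbf{L}(\mathfrak{H},\mathfrak{K}_n)$ of $T_n$ satisfy $$T_m^{**}\prec_c T_n^{**},\quad m\le n,\quad\text{and}\quad T_n^{**}\prec_c T^{**}.$$ Consequently, there exists a closed linear operator $S\in\mathbf{L}(\mathfrak{H},\mathfrak{K}_{\rm c})$, where $\mathfrak{K}_{\rm c}$ is a Hilbert space, such that $$\operatorname{dom}S=\Big\{\varphi\in\bigcap_{n\in\mathbb{N}}\operatorname{dom}T_n^{**}:\ \sup_{n\in\mathbb{N}}\|T_n^{**}\varphi\|<\infty\Big\}$$ and which satisfies $$T_n^{**}\prec_c S\prec_c T^{**}\quad\text{and}\quad\|T_n^{**}\varphi\|\nearrow\|S\varphi\|,\quad\varphi\in\operatorname{dom}S.$$ In fact, $\operatorname{dom}T^{**}\subset\operatorname{dom}S$,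 while $\|S\varphi\|=\|T^{**}\varphi\|$ for all $\varphi\in\operatorname{dom}T^{**}$.
   Context: $\mathbf{L}(\mathfrak{H},\mathfrak{K})$ denotes the class of all linear relations from the Hilbert space $\mathfrak{H}$ to the Hilbert space $\mathfrak{K}$, i.e. all linear subspaces of $\mathfrak{H}\times\mathfrak{K}$; a linear operator is a linear relation $T$ with $\{f':\{0,f'\}\in T\}=\{0\}$. Operators are defined on a linear subspace which need not be dense and need not be bounded. The adjoint of $T\in\mathbf{L}(\mathfrak{H},\mathfrak{K})$ is the relation $T^*=\{\{g,g'\}\in\mathfrak{K}\times\mathfrak{H}:(g',f)=(g,f')\text{ for all }\{f,f'\}\in T\}$, and $T^{**}$ is the closure of $T$ in $\mathfrak{H}\times\mathfrak{K}$. An operator $T$ is closable if $T^{**}$ is an operator and closed if $T=T^{**}$. Contractive domination: for $A\in\mathbf{L}(\mathfrak{H},\mathfrak{H}_A)$ and $B\in\mathbf{L}(\mathfrak{H},\mathfrak{H}_B)$ one writes $A\prec_c B$ if there is a contraction $C\in\mathbf{B}(\mathfrak{H}_B,\mathfrak{H}_A)$ (bounded, everywhere defined) with $CB\subset A$, where $CB=\{\{f,Cf'\}:\{f,f'\}\in B\}$. For linear operators this is equivalent to $\operatorname{dom}B\subset\operatorname{dom}A$ and $\|Af\|\le\|Bf\|$ for all $f\in\operatorname{dom}B$. The symbol $\nearrow$ denotes nondecreasing convergence as $n\to\infty$. *)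

(* Defs.v *)
From HB Require Import structures.
From mathcomp Require Import all_boot all_order all_algebra.
From mathcomp Require Import complex.
From mathcomp Require Import all_classical all_reals all_analysis.

Set Implicit Arguments.
Unset Strict Implicit.
Unset Printing Implicit Defensive.

Import Order.TTheory GRing.Theory Num.Theory.
Import numFieldNormedType.Exports.

Local Open Scope classical_set_scope.
Local Open Scope ring_scope.

(* A complex Hilbert space: a complete normed space over R[i] whose norm comes
   from an inner product, linear in the first argument and conjugate-linear in
   the second. *)
HB.mixin Record NormedModule_isHilbert (R : realType) V
    of NormedModule R[i] V := {
  inner : {dot V for @Num.conj R[i]} ;
  inner_normE : forall x : V, `|x| ^+ 2 = inner x x
}.

#[short(type="hilbertType")]
HB.structure Definition Hilbert (R : realType) :=
  {V of CompleteNormedModule R[i] V & NormedModule_isHilbert R V}.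

(* The norm of a normed module over R[i] takes its values in R[i]; [hnorm] is
   the same number, seen in R. *)
Definition hnorm (R : realType) (H : hilbertType R) (x : H) : R :=
  complex.Re `|x|.

Section LinearRelations.
Variable R : realType.
Implicit Types H K : hilbertType R.

Definition linear_relation H K (T : set (H * K)) : Prop :=
  submod_closed [in T].

Definition dom H K (T : set (H * K)) : set H := fst @` T.

Definition mul H K (T : set (H * K)) : set K := [set f' | T (0, f')].

Definition linear_operator H K (T : set (H * K)) : Prop :=
  linear_relation T /\ mul T = [set 0].

(* For an operator T and x in dom T this is the vector T x; it is 0 for x
   outside dom T. *)
Definition app H K (T : set (H * K)) (x : H) : K :=
  xget 0 [set y | T (x, y)].

Definition adjoint H K (T : set (H * K)) : set (K * H) :=
  [set g | forall f, T f -> inner g.2 f.1 = inner g.1 f.2].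

Definition biadjoint H K (T : set (H * K)) : set (H * K) :=
  adjoint (adjoint T).

Definition closable H K (T : set (H * K)) : Prop :=
  linear_operator (biadjoint T).

Definition closed_relation H K (T : set (H * K)) : Prop := T = biadjoint T.

Definition contraction H K (C : H -> K) : Prop := forall x, `|C x| <= `|x|.

Definition contr_dominated H (HA HB : hilbertType R)
    (A : set (H * HA)) (B : set (H * HB)) : Prop :=
  exists C : {linear HB -> HA},
    contraction C /\ [set (f.1, C f.2) | f in B] `<=` A.

Definition bounded_dom H (K : nat -> hilbertType R)
    (T : forall n, set (H * K n)) : set H :=
  [set x | (\bigcap_n dom (T n)) x /\
    (ereal_sup (range (fun n => (hnorm (app (T n) x))%:E)) < +oo)%E].

Definition norm_nearrow H (K : nat -> hilbertType R) (L : hilbertType R)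
    (T : forall n, set (H * K n)) (S : set (H * L)) (x : H) : Prop :=
  nondecreasing_seq (fun n => hnorm (app (T n) x)) /\
  hnorm (app (T n) x) @[n --> \oo] --> hnorm (app S x).

End LinearRelations.

Notation "A \prec_c B" := (contr_dominated A B)
  (at level 70, no associativity) : classical_set_scope.

(* Main.v *)
Require Import Defs.
From HB Require Import structures.
From mathcomp Require Import all_boot all_order all_algebra.
From mathcomp Require Import complex ring lra.
From mathcomp Require Import all_classical all_reals all_analysis.

(** Write A_n for the closure of T_n, an operator by closability.

    Domination passes to closures with the same contraction.  If C B is
    contained in A and C has the Hilbert space adjoint C*, then (g, g') in A*
    gives (C* g, g') in B*, and a second adjoint turns this into: C B** is
    contained in A** ([biadjoint_contraction]).  This settles the first two
    claims.

    For the existence of S, contractions C_n with C_n T_{n+1} contained in T_n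
    are fixed.  The vectors A_n x are then linked by C_n (A_{n+1} x) = A_n x,
    so x with bounded norms |A_n x| yields a bounded thread of the inverse
    system K_0 <- K_1 <- K_2 <- ...  The bounded threads form a Hilbert space
    Kc under the norm lim |k_n| ([inverse_limit]): these norms increase, the
    parallelogram law is inherited in the limit, and completeness is checked
    coordinatewise.  The operator S x = (A_n x)_n has exactly the required
    domain and norm.  It is closed because (x, k) belongs to S if and only if
    (x, k_n) belongs to A_n for every n, and the coordinate projections of Kc
    are contractions, so that the first claim applies to them.

    For the comparison with T**, contractions D_n with D_n T contained in T_n
    satisfy C_n D_{n+1} = D_n on ran T, hence on its closure, by continuity.
    Precomposing with the orthogonal projection P onto that closure makes the
    family D_n P compatible everywhere, so it factors through a contraction
    J : K -> Kc ([lim_universal]).  Since ran T** lies in the closure of ran T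
    ([ran_biadjoint]), J maps T** into S.  On ran T the contraction J is
    isometric, because |T_n x| converges to |T x|, and it stays isometric on
    the closure; so |S x| = |T** x| on dom T**.

    The geometry of Hilbert spaces enters through one variational argument
    ([linear_functional_repr]): a bounded functional is represented on a
    subspace N by a vector of the closure of N.  It gives adjoints for N the
    whole space, and orthogonal projections for the functional <., x>. *)

Set Implicit Arguments.
Unset Strict Implicit.
Unset Printing Implicit Defensive.

Import Order.TTheory GRing.Theory Num.Theory.
Import numFieldNormedType.Exports.

Local Open Scope classical_set_scope.
Local Open Scope ring_scope.
Local Open Scope complex_scope.

(* Short contractions between Hilbert spaces, not the q-Lipschitz maps of
   fixed-point theory. *)
Local Notation contraction := Defs.contraction.

(** * Norm and inner product of a Hilbert space *)

Lemma norm_hnorm (R : realType) (V : hilbertType R) (x : V) : `|x| = (hnorm x)%:C.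
Proof. by rewrite /hnorm RRe_real// ger0_real. Qed.

Section HilbertNorm.
Variables (R : realType) (V : hilbertType R).
Implicit Types x y z : V.

Lemma hnorm_ge0 x : 0 <= hnorm x.
Proof. by have := normr_ge0 x; rewrite norm_hnorm ler0c. Qed.

Lemma le_hnorm (W : hilbertType R) x (w : W) :
  (`|x| <= `|w|) = (hnorm x <= hnorm w).
Proof. by rewrite !norm_hnorm lecR. Qed.

Lemma hnorm0 : hnorm (0 : V) = 0.
Proof. by rewrite /hnorm normr0. Qed.

Lemma hnorm0_eq0 x : hnorm x = 0 -> x = 0.
Proof. by move=> x0; apply/normr0_eq0; rewrite norm_hnorm x0. Qed.

Lemma hnorm_le_eps_eq0 x : (forall e, 0 < e -> hnorm x <= e) -> x = 0.
Proof.
move=> h; apply/hnorm0_eq0/eqP; rewrite eq_le hnorm_ge0 andbT.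
by apply/ler_addgt0Pl => e e0; rewrite addr0 h.
Qed.

Lemma hnorm_opp x : hnorm (- x) = hnorm x.
Proof. by rewrite /hnorm normrN. Qed.

Lemma hnorm_distC x y : hnorm (x - y) = hnorm (y - x).
Proof. by rewrite -hnorm_opp opprB. Qed.

Lemma hnorm_scale (a : R[i]) x : (hnorm (a *: x))%:C = `|a| * (hnorm x)%:C.
Proof. by rewrite -!norm_hnorm normrZ. Qed.

Lemma hnorm_scale_real (a : R) x : hnorm (a%:C *: x) = `|a| * hnorm x.
Proof.
apply: complexI; rewrite hnorm_scale rmorphM/=.
by rewrite normc_def/= expr0n addr0 sqrtr_sqr.
Qed.

Lemma hnorm_triangle x y : hnorm (x + y) <= hnorm x + hnorm y.
Proof. by have := ler_normD x y; rewrite !norm_hnorm -rmorphD lecR. Qed.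

Lemma hnorm_triangleB x y z : hnorm (x - z) <= hnorm (x - y) + hnorm (y - z).
Proof. by rewrite (le_trans _ (hnorm_triangle _ _))// addrA subrK. Qed.

Lemma hnorm_rev_triangle x y : hnorm x <= hnorm (x - y) + hnorm y.
Proof. by rewrite (le_trans _ (hnorm_triangle _ _))// subrK. Qed.

Lemma hnorm_sqr x : hnorm x ^+ 2 = complex.Re (inner x x).
Proof. by rewrite -inner_normE norm_hnorm -rmorphXn. Qed.

Lemma innerPl a x y z : inner (a *: x + y) z = a * inner x z + inner y z.
Proof. exact: linearPl. Qed.

Lemma innerDl x y z : inner (x + y) z = inner x z + inner y z.
Proof. exact: linearDl. Qed.

Lemma innerDr x y z : inner x (y + z) = inner x y + inner x z.
Proof. exact: linearDr. Qed.

Lemma innerBl x y z : inner (x - y) z = inner x z - inner y z.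
Proof. exact: linearBl. Qed.

Lemma innerBr x y z : inner x (y - z) = inner x y - inner x z.
Proof. exact: linearBr. Qed.

Lemma innerNr x y : inner x (- y) = - inner x y.
Proof. exact: linearNr. Qed.

Lemma innerZl a x y : inner (a *: x) y = a * inner x y.
Proof. exact: linearZl_LR. Qed.

Lemma innerZr a x y : inner x (a *: y) = a^*%C * inner x y.
Proof. exact: linearZr_LR. Qed.

Lemma inner0l x : inner 0 x = 0. Proof. exact: linear0l. Qed.

Lemma inner0r x : inner x 0 = 0. Proof. exact: linear0r. Qed.

Lemma innerC x y : inner x y = (inner y x)^*%C.
Proof. by rewrite hermC mul1r. Qed.

Lemma Re_innerC x y : complex.Re (inner x y) = complex.Re (inner y x).
Proof. by rewrite innerC; case: (inner y x). Qed.

Lemma hnorm_sqrD x y :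
  hnorm (x + y) ^+ 2 = hnorm x ^+ 2 + hnorm y ^+ 2 + 2 * complex.Re (inner x y).
Proof.
rewrite !hnorm_sqr innerDl !innerDr !raddfD/= [complex.Re (inner y x)]Re_innerC.
by ring.
Qed.

Lemma hnorm_sqrB x y :
  hnorm (x - y) ^+ 2 = hnorm x ^+ 2 + hnorm y ^+ 2 - 2 * complex.Re (inner x y).
Proof. by rewrite hnorm_sqrD hnorm_opp innerNr raddfN/= mulrN. Qed.

Lemma parallelogram x y :
  hnorm (x + y) ^+ 2 + hnorm (x - y) ^+ 2 = 2 * hnorm x ^+ 2 + 2 * hnorm y ^+ 2.
Proof. by rewrite hnorm_sqrD hnorm_sqrB; ring. Qed.

Lemma Re_innerZ (a : R) x y :
  complex.Re (inner (a%:C *: x) y) = a * complex.Re (inner x y).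
Proof. by rewrite innerZl; case: (inner x y) => u v /=; rewrite mul0r subr0. Qed.

Lemma CauchySchwarz_Re x y : complex.Re (inner x y) <= hnorm x * hnorm y.
Proof.
have [x0|x0] := eqVneq (hnorm x) 0.
  by rewrite (hnorm0_eq0 x0) inner0l hnorm0 mul0r.
have [y0|y0] := eqVneq (hnorm y) 0.
  by rewrite (hnorm0_eq0 y0) inner0r hnorm0 mulr0.
have := sqr_ge0 (hnorm ((hnorm y)%:C *: x - (hnorm x)%:C *: y)).
rewrite hnorm_sqrB !hnorm_scale_real !ger0_norm ?hnorm_ge0// Re_innerZ.
rewrite Re_innerC Re_innerZ Re_innerC.
have {x0}: 0 < hnorm x by rewrite lt_def x0 hnorm_ge0.
have {y0}: 0 < hnorm y by rewrite lt_def y0 hnorm_ge0.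
move: (complex.Re _) (hnorm x) (hnorm y) => r a b b0 a0 H.
have : 0 <= (a * b) * (a * b - r) by lra.
by rewrite pmulr_rge0 ?mulr_gt0// subr_ge0.
Qed.

End HilbertNorm.

Lemma hnorm_ball (R : realType) (V : hilbertType R) (x : V) (e : R) :
  ball x e%:C = [set y | hnorm (x - y) < e].
Proof.
by rewrite -ball_normE; apply/seteqP; split=> y /=; rewrite norm_hnorm ltcR.
Qed.

Lemma complex_gt0 (R : realType) (e : R[i]) :
  0 < e -> exists2 r : R, 0 < r & e = r%:C.
Proof.
move=> e0; have /RRe_real eE := gtr0_real e0.
by exists (complex.Re e); rewrite // -ltcR eE.
Qed.

Lemma hilbert_complete (R : realType) (V : hilbertType R) (F : set_system V) :
  ProperFilter F ->
  (forall e : R, 0 < e -> exists x, F [set y | hnorm (x - y) < e]) ->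
  exists y, forall e : R, 0 < e -> F [set z | hnorm (y - z) < e].
Proof.
move=> FF Fc; have : cvg F.
  apply: cauchy_cvg; apply: cauchy_exP => _ /complex_gt0[e e0 ->].
  by have [x Fx] := Fc e e0; exists x; rewrite hnorm_ball.
move=> /cvg_ex[y Fy]; exists y => e e0.
by rewrite -hnorm_ball; apply: Fy; apply: nbhsx_ballx; rewrite ltcR.
Qed.

Lemma submod_setP (R : realType) (V : lmodType R[i]) (N : set V) :
  submod_closed [in N] <->
  N 0 /\ forall (a : R[i]) x y, N x -> N y -> N (a *: x + y).
Proof.
split=> [[N0 NZ]|[N0 NZ]]; split.
- exact/set_mem.
- move=> a x y Nx Ny; apply/set_mem/NZ; exact/mem_set.
- exact/mem_set.
- move=> a x y /set_mem Nx /set_mem Ny; exact/mem_set/NZ.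
Qed.

Lemma closure_hnormP (R : realType) (V : hilbertType R) (N : set V) (x : V) :
  closure N x <-> forall e, 0 < e -> exists2 m, N m & hnorm (x - m) < e.
Proof.
split=> [Nx e e0|Nx B /nbhs_ballP[_ /complex_gt0[e e0 ->] eB]].
  have [|m [Nm xm]] := Nx (ball x e%:C).
    by apply: nbhsx_ballx; rewrite ltcR.
  by exists m => //; rewrite hnorm_ball in xm.
have [m Nm xm] := Nx e e0; exists m; split => //.
by apply: eB; rewrite hnorm_ball.
Qed.

(** Optimality of t = 0 for a quadratic in t; the test point is - a / (h + 1),
    where the denominator is shifted to allow h = 0. *)
Lemma quadratic_ge0_lin_eq0 (R : realFieldType) (h a : R) : 0 <= h ->
  (forall t, 0 <= t ^+ 2 * h + 2 * t * a) -> a = 0.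
Proof.
move=> h0 H; pose s := (h + 1)^-1.
have h1 : 0 < h + 1 by rewrite ltr_wpDl.
have s0 : 0 < s by rewrite invr_gt0.
have sh : s * (h + 1) = 1 by rewrite mulVf// gt_eqF.
have := H (- (s * a)).
have -> : (- (s * a)) ^+ 2 * h + 2 * (- (s * a)) * a = - (s * a ^+ 2 * (1 + s)).
  have -> : s * a ^+ 2 * (1 + s) = s * a ^+ 2 * (2 - s * h).
    by congr (_ * _); lra.
  by ring.
rewrite oppr_ge0 pmulr_lle0; last by rewrite addr_gt0.
rewrite pmulr_rle0// => a2.
by apply/eqP; rewrite -sqrf_eq0 eq_le a2 sqr_ge0.
Qed.

(** The Riesz representation theorem on a subspace N that need not be closed.
    The functional F x = |x|^2 - 2 Re (l x) is bounded below on N, and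
    by the parallelogram law the set of its e-minimisers has diameter at most
    2 sqrt e; these sets thus form a Cauchy filter, and its limit y satisfies
    the Euler equation of F.  The minimum need not be attained in N, so the
    Euler equation is derived up to e at an e-minimiser near y. *)
Lemma linear_functional_repr (R : realType) (V : hilbertType R) (N : set V)
    (l : V -> R[i]) (M : R) :
  submod_closed [in N] -> scalar l ->
  (forall x, complex.Re (l x) <= M * hnorm x) ->
  exists2 y, closure N y & forall x, N x -> l x = inner x y.
Proof.
move=> /submod_setP[N0 NZ] llin lM.
have lZ a x : l (a *: x) = a * l x.
  have l0 : l 0 = 0.
    by have := llin 1 0 0; rewrite scaler0 addr0 mul1r -[X in X = _]addr0 => /addrI.
  by have := llin a x 0; rewrite !addr0 l0 addr0.
have lD x y : l (x + y) = l x + l y.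
  by have := llin 1 x y; rewrite scale1r mul1r.
have ND x y : N x -> N y -> N (x + y).
  by move=> Nx Ny; have := NZ 1 _ _ Nx Ny; rewrite scale1r.
have NsZ a x : N x -> N (a *: x).
  by move=> Nx; have := NZ a _ _ Nx N0; rewrite addr0.
have ReZ (a : R) z : complex.Re (a%:C * z) = a * complex.Re z.
  by case: z => u v /=; rewrite mul0r subr0.
pose F x : R := hnorm x ^+ 2 - 2 * complex.Re (l x).
have F_inf : has_inf (F @` N).
  split; first by exists (F 0), 0.
  exists (- M ^+ 2) => _ [x Nx <-].
  by rewrite /F; have := lM x; have := sqr_ge0 (hnorm x - M); lra.
pose d := inf (F @` N).
have dF x : N x -> d <= F x.
  by move=> Nx; apply: ge_inf; [exact: F_inf.2|exists x].
pose A e := [set x | N x /\ F x < d + e].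
have A_neq0 e : 0 < e -> A e !=set0.
  move=> e0; have [_ [x Nx <-] xe] := inf_adherent e0 F_inf.
  by exists x.
have A_diam e x y : A e x -> A e y -> hnorm (x - y) ^+ 2 < 4 * e.
  move=> [Nx Fx] [Ny Fy].
  have := dF _ (NsZ (2^-1)%:C _ (ND _ _ Nx Ny)).
  rewrite /F hnorm_scale_real lZ ReZ lD raddfD/= ger0_norm ?invr_ge0//.
  have := parallelogram x y; move: Fx Fy; rewrite /F.
  move: (hnorm (x + y)) (hnorm (x - y)) => u v; lra.
have A_filter : ProperFilter (filter_from [set e : R | 0 < e] A).
  apply: filter_from_proper => //.
  apply: filter_from_filter; first by exists 1 => /=.
  move=> e e' /= e0 e'0; exists (Num.min e e'); first by rewrite /= lt_min e0.
  by move=> x [Nx]; rewrite addr_minr lt_min => /andP[Fe Fe'].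
have [y yA] : exists y, forall e : R, 0 < e ->
    filter_from [set e : R | 0 < e] A [set z | hnorm (y - z) < e].
  apply: hilbert_complete => e e0.
  have e2 : 0 < (e / 2) ^+ 2 by rewrite exprn_gt0// divr_gt0.
  have [x Ax] := A_neq0 _ e2; exists x; exists ((e / 2) ^+ 2) => //= z Az.
  rewrite /= -(@ltr_pXn2r _ 2) ?nnegrE ?hnorm_ge0 ?(ltW e0)//.
  by rewrite (lt_le_trans (A_diam _ _ _ Ax Az))//; lra.
have yN e : 0 < e -> exists2 m, A e m & hnorm (y - m) < e.
  move=> e0; have [e' e'0 e'y] := yA e e0.
  have [m [Nm Fm]] : A (Num.min e e') !=set0.
    by apply: A_neq0; rewrite lt_min e0.
  exists m.
    by split => //; apply: (lt_le_trans Fm); rewrite lerD2l ge_min lexx.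
  apply: e'y; split => //; apply: (lt_le_trans Fm).
  by rewrite lerD2l ge_min lexx orbT.
exists y.
  by apply/closure_hnormP => e /yN[m [Nm _] ym]; exists m.
have Re0 x : N x -> complex.Re (inner x y) = complex.Re (l x).
  move=> Nx.
  pose a := complex.Re (inner x y) - complex.Re (l x).
  suff H : forall t e, 0 < e ->
      0 <= (t ^+ 2 * hnorm x ^+ 2 + 2 * t * a) + (2 * `|t| * hnorm x + 1) * e.
    apply/eqP; rewrite -subr_eq0; apply/eqP.
    apply: (@quadratic_ge0_lin_eq0 _ (hnorm x ^+ 2)) => [|t]; first exact: sqr_ge0.
    apply/ler_addgt0Pr => e e0.
    have q0 : 0 < 2 * `|t| * hnorm x + 1.
      by rewrite ltr_wpDl// !mulr_ge0// hnorm_ge0.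
    have := H t _ (divr_gt0 e0 q0).
    by rewrite [_ * (e / _)]mulrC divfK// gt_eqF.
  (* compare F at the e-minimiser m with F at m + t x *)
  move=> t e e0.
  have [m [Nm Fm] ym] := yN e e0.
  have := dF _ (ND _ _ Nm (NsZ t%:C _ Nx)).
  have := CauchySchwarz_Re (t%:C *: x) (m - y).
  rewrite Re_innerZ hnorm_scale_real innerBr raddfB/= -hnorm_distC => cs.
  have : `|t| * hnorm x * hnorm (y - m) <= `|t| * hnorm x * e.
    by rewrite ler_wpM2l ?mulr_ge0 ?hnorm_ge0// ltW.
  move: Fm cs; rewrite /F hnorm_sqrD hnorm_scale_real exprMn lD raddfD/= lZ ReZ.
  rewrite [complex.Re (inner m _)]Re_innerC Re_innerZ real_normK ?num_real//.
  rewrite /a; move: (complex.Re (inner x m)) (complex.Re (inner x y)) => p q.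
  lra.
(* the imaginary parts agree because the real parts agree at i x *)
move=> x Nx.
apply/eqP; rewrite eq_complex Re0// eqxx/=; apply/eqP.
have := Re0 _ (NsZ 'i x Nx); rewrite lZ innerZl.
by case: (l x) (inner x y) => u v [u' v'] /=; lra.
Qed.

(** * Contractions and orthogonal projections *)

Lemma contraction_hnorm (R : realType) (V W : hilbertType R) (C : V -> W) x :
  contraction C -> hnorm (C x) <= hnorm x.
Proof. by move=> /(_ x); rewrite le_hnorm. Qed.

(** [y] is the value at [g] of the adjoint of [C]. *)
Lemma contraction_adjoint (R : realType) (V W : hilbertType R)
    (C : {linear V -> W}) (g : W) :
  contraction C -> exists y, forall x, inner (C x) g = inner x y.
Proof.
move=> C1.
have [||x|y _ Cy] :=
  @linear_functional_repr R V setT (fun x => inner (C x) g) (hnorm g).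
- by apply/submod_setP.
- by move=> a u v; rewrite linearP/= innerPl.
- rewrite (le_trans (CauchySchwarz_Re _ _))// mulrC ler_wpM2l ?hnorm_ge0//.
  exact: contraction_hnorm.
- by exists y => x; apply: Cy.
Qed.

Definition orthocomp (R : realType) (V : hilbertType R) (N : set V) : set V :=
  [set x | forall m, N m -> inner x m = 0].

Section Projection.
Variables (R : realType) (V : hilbertType R) (N : set V).

Lemma orthocomp_submod : submod_closed [in orthocomp N].
Proof.
apply/submod_setP; split => [m _|a x y Nx Ny m Nm]; first by rewrite inner0l.
by rewrite innerPl Nx// Ny// mulr0 addr0.
Qed.

Lemma orthocompB x y : orthocomp N x -> orthocomp N y -> orthocomp N (x - y).
Proof. by move=> Nx Ny m Nm; rewrite innerBl Nx// Ny// subrr. Qed.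

Lemma orthocomp_self_eq0 x : orthocomp N x -> orthocomp (orthocomp N) x -> x = 0.
Proof.
move=> Nx NNx; apply/hnorm0_eq0/eqP; rewrite -sqrf_eq0 hnorm_sqr.
by rewrite (NNx _ Nx).
Qed.

Lemma closure_biorthocomp : closure N `<=` orthocomp (orthocomp N).
Proof.
move=> y /closure_hnormP yN z Nz.
(* applied to z, -z, iz and -iz, this bound kills both parts of <y, z> *)
suff Re0 w : orthocomp N w -> complex.Re (inner y w) <= 0.
  have NZ a : orthocomp N (a *: z).
    have /submod_setP[N0 /(_ a z 0 Nz N0)] := orthocomp_submod.
    by rewrite addr0.
  have := (Re0 z Nz, Re0 _ (NZ (-1)), Re0 _ (NZ 'i), Re0 _ (NZ (-'i))).
  rewrite !innerZr; case: (inner y z) => u v /=.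
  move=> [[[]]] *; apply/eqP; rewrite eq_complex/=.
  by apply/andP; split; apply/eqP; lra.
move=> Nw; apply/ler_addgt0Pl => e e0; rewrite addr0.
have w0 : 0 < hnorm w + 1 by rewrite ltr_wpDl// hnorm_ge0.
have [m Nm ym] := yN (e / (hnorm w + 1)) (divr_gt0 e0 w0).
have -> : inner y w = inner (y - m) w.
  by rewrite innerBl [inner m w]innerC Nw// conjc0 subr0.
rewrite (le_trans (CauchySchwarz_Re _ _))//.
rewrite (@le_trans _ _ (hnorm (y - m) * (hnorm w + 1)))//.
  by rewrite ler_wpM2l ?hnorm_ge0// lerDl.
by rewrite -ler_pdivlMr// ltW.
Qed.

Hypothesis N_submod : submod_closed [in N].

(** The component of x in the closure of N is the vector representing the
    functional <., x> on N. *)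
Lemma orthogonal_decomposition x :
  exists2 y, closure N y & orthocomp N (x - y).
Proof.
have [||z|y yN Ny] := @linear_functional_repr R V N (inner^~ x) (hnorm x).
- exact: N_submod.
- by move=> a u v; rewrite innerPl.
- by rewrite mulrC; exact: CauchySchwarz_Re.
- exists y => // m Nm.
  by rewrite innerC innerBr Ny// subrr conjc0.
Qed.

Lemma biorthocompE : orthocomp (orthocomp N) = closure N.
Proof.
apply/seteqP; split=> [x NNx|]; last exact: closure_biorthocomp.
have [y yN Nxy] := orthogonal_decomposition x.
suff /subr0_eq -> : x - y = 0 by [].
apply: orthocomp_self_eq0 => // z Nz.
by rewrite innerBl NNx// (closure_biorthocomp yN Nz) subrr.
Qed.

(** The orthogonal projection onto the closure of N.  The decomposition is
    unique because the closure of N meets the complement of N only in 0, and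
    uniqueness makes it linear. *)
Lemma orthogonal_projection : exists P : {linear V -> V},
  [/\ contraction P, forall x, closure N (P x) &
      forall x, closure N x -> P x = x].
Proof.
have : forall x, exists y, orthocomp (orthocomp N) y /\ orthocomp N (x - y).
  move=> x; have [y yN Ny] := orthogonal_decomposition x.
  by exists y; split => //; exact: closure_biorthocomp.
rewrite -biorthocompE => /choice[P PP].
have P_unique x y : orthocomp (orthocomp N) y -> orthocomp N (x - y) -> P x = y.
  move=> NNy Ny; have [NNp Np] := PP x; apply: subr0_eq.
  apply: orthocomp_self_eq0 => z Nz; last by rewrite innerBl NNp// NNy// subrr.
  have -> : P x - y = x - y - (x - P x) by rewrite opprB [RHS]addrC addrA subrK.
  exact: orthocompB Ny Np _ Nz.
have P_linear : linear P.
  move=> a x y; apply: P_unique => z Nz.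
    by rewrite innerPl (PP x).1// (PP y).1// mulr0 addr0.
  have -> : a *: x + y - (a *: P x + P y) = a *: (x - P x) + (y - P y).
    by rewrite scalerBr addrACA opprD.
  by rewrite innerPl (PP x).2// (PP y).2// mulr0 addr0.
pose P' : {linear V -> V} :=
  HB.pack P (GRing.isLinear.Build _ _ _ _ P P_linear).
exists P'; split=> [x|x|x NNx].
- rewrite le_hnorm -(ler_pXn2r (ltn0Sn 1)) ?nnegrE ?hnorm_ge0//.
  have [NNp Np] := PP x.
  (* Pythagoras *)
  have := hnorm_sqrD (P x) (x - P x).
  rewrite [P x + _]addrC subrK (NNp _ Np) mulr0 addr0 => ->.
  by rewrite lerDl sqr_ge0.
- exact: (PP x).1.
- by apply: P_unique => //; rewrite subrr => z Nz; rewrite inner0l.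
Qed.

End Projection.

(** A contraction is 1-Lipschitz, so what it does on N determines what it does
    on the closure of N. *)
Lemma contraction_eq_closure (R : realType) (V W : hilbertType R) (N : set V)
    (f g : {linear V -> W}) : contraction f -> contraction g ->
  (forall x, N x -> f x = g x) -> forall x, closure N x -> f x = g x.
Proof.
move=> f1 g1 fg x /closure_hnormP xN; apply: subr0_eq.
apply: hnorm_le_eps_eq0 => e e0.
have [m Nm /ltW xm] := xN (e / 2) (divr_gt0 e0 (ltr0Sn _ 1)).
have -> : f x - g x = f (x - m) - g (x - m).
  by rewrite (raddfB f) (raddfB g) /= (fg m Nm) opprB addrA subrK.
rewrite (le_trans (hnorm_triangle _ _))// hnorm_opp [leRHS](splitr e).
by rewrite lerD// (le_trans (contraction_hnorm _ _)).
Qed.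

Lemma contraction_isometry_closure (R : realType) (V W : hilbertType R)
    (N : set V) (f : {linear V -> W}) : contraction f ->
  (forall x, N x -> hnorm (f x) = hnorm x) ->
  forall x, closure N x -> hnorm (f x) = hnorm x.
Proof.
move=> f1 fN x /closure_hnormP xN.
apply/eqP; rewrite eq_le (contraction_hnorm _ f1)/=.
apply/ler_addgt0Pr => e e0.
have [m Nm /ltW xm] := xN (e / 2) (divr_gt0 e0 (ltr0Sn _ 1)).
rewrite (le_trans (hnorm_rev_triangle _ m))// -(fN _ Nm).
rewrite (_ : hnorm (f x) + e = e / 2 + (e / 2 + hnorm (f x))); last by lra.
rewrite lerD// (le_trans (hnorm_rev_triangle _ (f x)))// lerD//.
by rewrite -raddfB (le_trans (contraction_hnorm _ f1))// hnorm_distC.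
Qed.

(** * Closures of linear relations *)

(** For (g, g') in the adjoint of A, the pair (C* g, g') lies in the adjoint of
    B, so that <C f', g> = <f', C* g> = <f, g'> for every (f, f') in the closure
    of B. *)
Lemma biadjoint_contraction (R : realType) (H HA HB : hilbertType R)
    (C : {linear HB -> HA}) (A : set (H * HA)) (B : set (H * HB)) :
  contraction C -> [set (f.1, C f.2) | f in B] `<=` A ->
  [set (f.1, C f.2) | f in biadjoint B] `<=` biadjoint A.
Proof.
move=> C1 CBA _ [f Bf <-] [g1 g2] Ag /=.
have [y Cy] := contraction_adjoint g1 C1.
rewrite Cy; apply: (Bf (y, g2)) => h Bh /=.
(* (y, g2) lies in the adjoint of B *)
rewrite (Ag (h.1, C h.2)) /=; first by rewrite innerC Cy -innerC.
by apply: CBA; exists h.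
Qed.

Lemma contr_dominated_biadjoint (R : realType) (H HA HB : hilbertType R)
    (A : set (H * HA)) (B : set (H * HB)) :
  A \prec_c B -> biadjoint A \prec_c biadjoint B.
Proof.
by move=> [C [C1 CBA]]; exists C; split => //; exact: biadjoint_contraction.
Qed.

Lemma biadjoint_submod (R : realType) (H K : hilbertType R) (T : set (H * K)) :
  linear_relation (biadjoint T).
Proof.
apply/submod_setP; split => [g _|a x y Tx Ty g Tg] /=; first by rewrite !inner0l.
by rewrite !innerPl Tx// Ty.
Qed.

Lemma sub_biadjoint (R : realType) (H K : hilbertType R) (T : set (H * K)) :
  T `<=` biadjoint T.
Proof.
move=> f Tf g Tg /=.
by rewrite innerC -(Tg f Tf) -innerC.
Qed.

Lemma adjointS (R : realType) (H K : hilbertType R) (S T : set (H * K)) :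
  S `<=` T -> adjoint T `<=` adjoint S.
Proof. by move=> ST g Tg f /ST/Tg. Qed.

Lemma biadjoint_closed (R : realType) (H K : hilbertType R) (T : set (H * K)) :
  closed_relation (biadjoint T).
Proof.
apply/seteqP; split; first exact: sub_biadjoint.
by apply: adjointS; exact: sub_biadjoint.
Qed.

Section Operators.
Variables (R : realType) (H K : hilbertType R).
Implicit Types A : set (H * K).

Lemma operator_unique A x y z : linear_operator A -> A (x, y) -> A (x, z) -> y = z.
Proof.
move=> [/submod_setP[_ AZ] A0] Axy Axz.
have : Defs.mul A (z - y).
  have := AZ (-1) _ _ Axy Axz; rewrite scaleN1r addrC.
  by rewrite -[_ - _]/(x - x, z - y) subrr.
by rewrite A0 => /subr0_eq.
Qed.

Lemma appE A x y : linear_operator A -> A (x, y) -> app A x = y.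
Proof.
move=> Aop Axy; apply/esym/(operator_unique Aop Axy).
exact: (@xgetPex _ 0 [set z | A (x, z)]) (ex_intro _ y Axy).
Qed.

Lemma app_dom A x : linear_operator A -> dom A x -> A (x, app A x).
Proof. by move=> Aop [[x' y] Axy /= <-]; rewrite (appE Aop Axy). Qed.

Lemma domP A x : dom A x <-> exists y, A (x, y).
Proof. by split=> [[[x' y] Axy <-]|[y Axy]]; [exists y|exists (x, y)]. Qed.

Lemma ran_submod A : linear_relation A -> submod_closed [in snd @` A].
Proof.
move=> /submod_setP[A0 AZ]; apply/submod_setP; split; first by exists 0.
by move=> a _ _ [p Ap <-] [q Aq <-]; exists (a *: p + q) => //; exact: AZ.
Qed.

(** A vector g orthogonal to ran A gives (g, 0) in the adjoint of A. *)
Lemma ran_biadjoint A f : linear_relation A -> biadjoint A f ->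
  closure (snd @` A) f.2.
Proof.
move=> /ran_submod A_submod Af; rewrite -biorthocompE// => g Ag.
have /= -> := Af (g, 0); first by rewrite inner0r.
by move=> h Ah /=; rewrite inner0l (Ag h.2)//; exists h.
Qed.

End Operators.

(** * The inverse limit of a sequence of contractions *)

Lemma cvg_seq_unique (R : realType) (u : nat -> R) (a b : R) :
  u @ \oo --> a -> u @ \oo --> b -> a = b.
Proof. exact: (cvg_unique (@Rhausdorff R)). Qed.

(** Limits of inner products are taken separately on real and imaginary parts:
    the real part is controlled by norms through polarization, and the imaginary
    part is the real part of <x, i y>. *)
Definition cvgC (R : realType) (u : nat -> R[i]) (l : R[i]) : Prop :=
  complex.Re (u n) @[n --> \oo] --> complex.Re l /\
  complex.Im (u n) @[n --> \oo] --> complex.Im l.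

Section ComplexLimit.
Variable R : realType.
Implicit Types (u v : nat -> R[i]) (a b : R[i]).

Lemma cvgC_eq u a b : cvgC u a -> cvgC u b -> a = b.
Proof.
move=> [ra ia] [rb ib]; apply/eqP; rewrite eq_complex.
by rewrite (cvg_seq_unique ra rb) (cvg_seq_unique ia ib) !eqxx.
Qed.

Lemma cvgCP a u v b c : cvgC u b -> cvgC v c ->
  cvgC (fun n => a * u n + v n) (a * b + c).
Proof.
case: a b c => [x y] [b b'] [c c'] [/= ub ub'] [/= vc vc']; split => /=.
- rewrite (_ : (fun n => _) = fun n =>
      (x * complex.Re (u n) - y * complex.Im (u n)) + complex.Re (v n)).
    by apply: cvgD => //; apply: cvgB; apply: cvgMr.
  by apply/funext => n; case: (u n) (v n) => ? ? [].
- rewrite (_ : (fun n => _) = fun n =>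
      (x * complex.Im (u n) + y * complex.Re (u n)) + complex.Im (v n)).
    by apply: cvgD => //; apply: cvgD; apply: cvgMr.
  by apply/funext => n; case: (u n) (v n) => ? ? [].
Qed.

Lemma cvgC_conj u a : cvgC u a -> cvgC (fun n => (u n)^*%C) a^*%C.
Proof.
move=> [ra ia]; split.
  rewrite (_ : complex.Re a^*%C = complex.Re a); last by case: (a).
  rewrite (_ : (fun n => _) = fun n => complex.Re (u n))//.
  by apply/funext => n; case: (u n).
rewrite (_ : complex.Im a^*%C = - complex.Im a); last by case: (a).
rewrite (_ : (fun n => _) = fun n => - complex.Im (u n)); first exact: cvgN.
by apply/funext => n; case: (u n).
Qed.

End ComplexLimit.

Section InverseLimit.
Variables (R : realType) (K : nat -> hilbertType R).
Variable C : forall n, {linear K n.+1 -> K n}.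

(** Boundedness is part of the notion: the norms of the coordinates increase,
    so it is what makes their limit a norm. *)
Definition is_thread (k : forall n, K n) : Prop :=
  (forall n, C n (k n.+1) = k n) /\ exists M : R, forall n, hnorm (k n) <= M.

(** The type mentions the contraction proofs [C1] because the norm of a thread is
    a limit that exists only by monotonicity, that is, by [C1]. *)
Record inverse_limit (C1 : forall n, contraction (C n)) := Thread {
  thread_val :> forall n, K n;
  threadP : is_thread thread_val }.

Lemma thread0 : is_thread (fun n => 0).
Proof.
by split=> [n|]; [rewrite raddf0|exists 0 => n; rewrite hnorm0].
Qed.

Lemma threadZD (a : R[i]) x y : is_thread x -> is_thread y ->
  is_thread (fun n => a *: x n + y n).
Proof.
move=> [Cx [M xM]] [Cy [N yN]]; split=> [n|]; first by rewrite linearP Cx Cy.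
exists (complex.Re `|a| * M + N) => n.
rewrite (le_trans (hnorm_triangle _ _))// lerD//.
have aE : (complex.Re `|a|)%:C = `|a| by rewrite RRe_real// ger0_real.
have -> : hnorm (a *: x n) = complex.Re `|a| * hnorm (x n).
  by apply: complexI; rewrite hnorm_scale rmorphM/= aE.
by rewrite ler_wpM2l// -ler0c aE.
Qed.

Variable C1 : forall n, contraction (C n).
Let L := inverse_limit C1.

HB.instance Definition _ := gen_eqMixin (inverse_limit C1).
HB.instance Definition _ := gen_choiceMixin (inverse_limit C1).

Lemma thread_eq (x y : L) : (forall n, x n = y n) -> x = y.
Proof.
case: x y => [x xP] [y yP] /= xy.
have {}xy : x = y by apply: functional_extensionality_dep.
by subst y; congr Thread; exact: Prop_irrelevance.
Qed.

Definition lim0 : L := Thread C1 thread0.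

(** One closure property, of a x + y, serves for addition, opposite and
    scaling alike. *)
Definition limPl (a : R[i]) (x y : L) : L :=
  Thread C1 (threadZD a (threadP x) (threadP y)).
Definition lim_add x y := limPl 1 x y.
Definition lim_opp x := limPl (-1) x lim0.
Definition lim_scale a x := limPl a x lim0.

Lemma lim_addA : associative lim_add.
Proof. by move=> x y z; apply: thread_eq => n /=; rewrite !scale1r addrA. Qed.
Lemma lim_addC : commutative lim_add.
Proof. by move=> x y; apply: thread_eq => n /=; rewrite !scale1r addrC. Qed.
Lemma lim_add0 : left_id lim0 lim_add.
Proof. by move=> x; apply: thread_eq => n /=; rewrite scale1r add0r. Qed.
Lemma lim_addN : left_inverse lim0 lim_opp lim_add.
Proof.
by move=> x; apply: thread_eq => n /=; rewrite scale1r addr0 scaleN1r addNr.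
Qed.
HB.instance Definition _ := GRing.isZmodule.Build (inverse_limit C1)
  lim_addA lim_addC lim_add0 lim_addN.

Lemma thread_addE (x y : L) n : (x + y) n = x n + y n.
Proof. by rewrite /= scale1r. Qed.

Lemma lim_scaleA a b (x : L) : lim_scale a (lim_scale b x) = lim_scale (a * b) x.
Proof. by apply: thread_eq => n /=; rewrite !addr0 scalerA. Qed.
Lemma lim_scale1 : left_id 1 lim_scale.
Proof. by move=> x; apply: thread_eq => n /=; rewrite addr0 scale1r. Qed.
Lemma lim_scaleDr : right_distributive lim_scale +%R.
Proof.
move=> a x y; apply: thread_eq => n.
by rewrite /= !addr0 !scale1r scalerDr.
Qed.
Lemma lim_scaleDl (x : L) : {morph lim_scale^~ x : a b / a + b}.
Proof.
move=> a b; apply: thread_eq => n.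
by rewrite /= !addr0 !scale1r scalerDl.
Qed.
HB.instance Definition _ := GRing.Zmodule_isLmodule.Build R[i] (inverse_limit C1)
  lim_scaleA lim_scale1 lim_scaleDr lim_scaleDl.

Lemma thread_scaleE a (x : L) n : (a *: x) n = a *: x n.
Proof. by rewrite /= addr0. Qed.

Lemma thread_oppE (x : L) n : (- x) n = - x n.
Proof. by rewrite /= addr0 scaleN1r. Qed.

Lemma thread_subE (x y : L) n : (x - y) n = x n - y n.
Proof. by rewrite thread_addE thread_oppE. Qed.

Definition thread_norm (x : L) : R := lim (hnorm (x n) @[n --> \oo]).

Lemma thread_nondecreasing (x : L) : nondecreasing_seq (fun n => hnorm (x n)).
Proof.
apply/nondecreasing_seqP => n; have [Cx _] := threadP x.
by rewrite -Cx; apply: contraction_hnorm.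
Qed.

Lemma thread_cvg (x : L) : hnorm (x n) @[n --> \oo] --> thread_norm x.
Proof.
apply: nondecreasing_is_cvgn; first exact: thread_nondecreasing.
have [_ [M xM]] := threadP x.
by exists M => _ [n _ <-].
Qed.

Lemma hnorm_thread_le (x : L) n : hnorm (x n) <= thread_norm x.
Proof.
apply: nondecreasing_cvgn_le; first exact: thread_nondecreasing.
apply/cvg_ex; eexists; exact: thread_cvg.
Qed.

Lemma thread_norm_le (x : L) M : (forall n, hnorm (x n) <= M) -> thread_norm x <= M.
Proof.
move=> xM; apply: limr_le; last by near=> n.
apply/cvg_ex; eexists; exact: thread_cvg.
Unshelve. all: by end_near. Qed.

Lemma thread_normD (x y : L) :
  (thread_norm (x + y))%:C <= (thread_norm x)%:C + (thread_norm y)%:C.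
Proof.
rewrite -rmorphD lecR; apply: thread_norm_le => n; rewrite thread_addE.
by rewrite (le_trans (hnorm_triangle _ _))// lerD// hnorm_thread_le.
Qed.

Lemma thread_normZ (a : R[i]) (x : L) :
  (thread_norm (a *: x))%:C = `|a| * (thread_norm x)%:C.
Proof.
have aE : (complex.Re `|a|)%:C = `|a| by rewrite RRe_real// ger0_real.
rewrite -aE -rmorphM; congr (_%:C); apply: (cvg_seq_unique (@thread_cvg (a *: x))).
rewrite (_ : (fun n => _) = fun n => complex.Re `|a| * hnorm (x n)).
  by apply: cvgMr; exact: thread_cvg.
apply/funext => n; apply: complexI.
by rewrite thread_scaleE hnorm_scale rmorphM/= aE.
Qed.

Lemma thread_norm_eq0 (x : L) : (thread_norm x)%:C = 0 -> x = 0.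
Proof.
move=> [x0]; apply: thread_eq => n; apply: hnorm0_eq0; apply/eqP.
by rewrite eq_le hnorm_ge0 -x0 hnorm_thread_le.
Qed.

HB.instance Definition _ := Lmodule_isNormed.Build R[i] (inverse_limit C1)
  thread_normD thread_normZ thread_norm_eq0.

Lemma thread_normE (x : L) : `|x| = (thread_norm x)%:C.
Proof. by []. Qed.

(** The coordinates of a Cauchy filter converge since the projections are
    contractions; the limits are linked by the [C n] by continuity, and bounds on
    all coordinates pass to the norm of the inverse limit. *)
Lemma inverse_limit_complete (F : set_system L) :
  ProperFilter F -> cauchy F -> cvg F.
Proof.
move=> FF /cauchyP Fc.
have {}Fc (e : R) : 0 < e -> exists x : L, F [set y : L | thread_norm (x - y) < e].
  move=> e0; have [x Fx] := Fc e%:C ltac:(by rewrite ltcR).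
  exists x; apply: filterS Fx; rewrite -ball_normE => y /=.
  by rewrite thread_normE ltcR.
have yP n : exists y : K n, forall e : R, 0 < e ->
      F [set z : L | hnorm (y - z n) < e].
  apply: (@hilbert_complete _ _ ((fun z : L => z n) @ F)) => e /Fc[x Fx].
  exists (x n); change (F [set z : L | hnorm (x n - z n) < e]).
  apply: filterS Fx => z /=; apply: le_lt_trans.
  by rewrite -thread_subE hnorm_thread_le.
pose y n := sval (cid (yP n)).
have yF n (e : R) : 0 < e -> F [set z : L | hnorm (y n - z n) < e].
  exact: (svalP (cid (yP n))).
have yx (e : R) (x : L) : F [set y : L | thread_norm (x - y) < e] ->
    forall n, hnorm (y n - x n) <= e.
  move=> Fx n; apply/ler_addgt0Pr => d d0.
  have [z [/= xz yz]] := filter_ex (filterI Fx (yF n d d0)).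
  rewrite (le_trans (hnorm_triangleB _ (z n) _))// addrC lerD ?ltW//.
  rewrite hnorm_distC (le_lt_trans _ xz)//.
  by rewrite -thread_subE hnorm_thread_le.
have y_thread : is_thread y.
  split=> [n|].
    apply/eqP; rewrite -subr_eq0; apply/eqP; apply: hnorm_le_eps_eq0 => e e0.
    have e2 : 0 < e / 2 by rewrite divr_gt0.
    have [x /yx Fx] := Fc _ e2.
    rewrite (le_trans (hnorm_triangleB _ (x n) _))// [leRHS](splitr e).
    rewrite lerD//; last by rewrite hnorm_distC.
    have [<- _] := threadP x; rewrite -raddfB.
    by rewrite (le_trans (contraction_hnorm _ (@C1 n))).
  have [x /yx Fx] := Fc 1 ltr01; exists (1 + thread_norm x) => n.
  rewrite (le_trans (hnorm_rev_triangle _ (x n)))// lerD//.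
  exact: hnorm_thread_le.
apply/cvg_ex; exists (Thread C1 y_thread : L).
apply/cvgrPdist_le => _ /complex_gt0[e e0 ->].
have e2 : 0 < e / 2 by rewrite divr_gt0.
have [x Fx] := Fc _ e2.
apply: filterS (Fx) => z /= xz; rewrite thread_normE lecR.
apply: thread_norm_le => n; rewrite thread_subE/=.
rewrite (le_trans (hnorm_triangleB _ (x n) _))// [leRHS](splitr e) lerD//.
  exact: yx.
by rewrite -thread_subE (le_trans (hnorm_thread_le _ _))// ltW.
Qed.

HB.instance Definition _ :=
  Uniform_isComplete.Build (inverse_limit C1) inverse_limit_complete.

(** Polarization, which makes the limit of Re <x n, y n> a limit of norms. *)
Definition thread_Re_inner (x y : L) : R :=
  (thread_norm (x + y) ^+ 2 - thread_norm (x - y) ^+ 2) / 4.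

(** Im <x, y> = Re <x, i y>, the form being conjugate-linear on the right. *)
Definition thread_inner (x y : L) : R[i] :=
  thread_Re_inner x y +i* thread_Re_inner x ('i *: y).

Lemma thread_Re_inner_cvg (x y : L) :
  complex.Re (inner (x n) (y n)) @[n --> \oo] --> thread_Re_inner x y.
Proof.
rewrite (_ : (fun n => _) = fun n =>
    (hnorm ((x + y) n) ^+ 2 - hnorm ((x - y) n) ^+ 2) / 4).
  apply: cvgMl; rewrite !expr2; under eq_fun do rewrite !expr2.
  by apply: cvgB; apply: cvgM; exact: thread_cvg.
apply/funext => n; rewrite thread_addE thread_subE hnorm_sqrD hnorm_sqrB.
by field.
Qed.

Lemma thread_inner_cvg (x y : L) :
  cvgC (fun n => inner (x n) (y n)) (thread_inner x y).
Proof.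
split => /=; first exact: thread_Re_inner_cvg.
rewrite (_ : (fun n => _) = fun n => complex.Re (inner (x n) (('i *: y) n))).
  exact: thread_Re_inner_cvg.
apply/funext => n; rewrite thread_scaleE innerZr.
by case: (inner (x n) (y n)) => u v /=; ring.
Qed.

Lemma thread_inner_linear z : scalar (thread_inner^~ z).
Proof.
move=> a x y; apply: (cvgC_eq (thread_inner_cvg _ _)).
rewrite (_ : (fun n => _) = fun n => a * inner (x n) (z n) + inner (y n) (z n)).
  by apply: cvgCP; exact: thread_inner_cvg.
by apply/funext => n; rewrite thread_addE thread_scaleE innerPl.
Qed.

Lemma thread_innerC (x y : L) : thread_inner x y = (thread_inner y x)^*%C.
Proof.
apply: (cvgC_eq (thread_inner_cvg _ _)).
rewrite (_ : (fun n => _) = fun n => (inner (y n) (x n))^*%C).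
  by apply: cvgC_conj; exact: thread_inner_cvg.
by apply/funext => n; rewrite innerC.
Qed.

Lemma thread_inner_normE (x : L) : `|x| ^+ 2 = thread_inner x x.
Proof.
apply: (@cvgC_eq _ (fun n => inner (x n) (x n))); last exact: thread_inner_cvg.
rewrite (_ : (fun n => _) = fun n => (hnorm (x n) ^+ 2)%:C); last first.
  by apply/funext => n; rewrite -inner_normE norm_hnorm rmorphXn.
rewrite thread_normE -rmorphXn; split => /=; last exact: cvg_cst.
rewrite expr2; under eq_fun do rewrite expr2.
by apply: cvgM; exact: thread_cvg.
Qed.

Lemma thread_inner_bilinear : bilinear_for
  ( *%R : GRing.Scale.law R[i] R[i])
  (@Num.conj R[i] \; *%R : GRing.Scale.law R[i] R[i]) thread_inner.
Proof.
split=> z; first exact: thread_inner_linear.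
move=> a x y.
rewrite /= [LHS]thread_innerC thread_inner_linear [thread_inner z x]thread_innerC.
by rewrite [thread_inner z y]thread_innerC rmorphD rmorphM.
Qed.

HB.instance Definition _ := bilinear_isBilinear.Build _ _ _ _ _ _
  thread_inner thread_inner_bilinear.

Lemma thread_inner_hermitian x y :
  thread_inner x y = (-1) ^+ false * Num.conj (thread_inner y x).
Proof. by rewrite mul1r thread_innerC. Qed.

HB.instance Definition _ := isHermitianSesquilinear.Build _ _ _ _
  thread_inner thread_inner_hermitian.

Lemma thread_inner_gt0 x : x != 0 -> 0 < thread_inner x x.
Proof. by move=> x0; rewrite -thread_inner_normE exprn_gt0// normr_gt0. Qed.

HB.instance Definition _ := isDotProduct.Build _ _ thread_inner thread_inner_gt0.

HB.instance Definition _ :=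
  NormedModule_isHilbert.Build R (inverse_limit C1) thread_inner_normE.

End InverseLimit.

Section Universal.
Variables (R : realType) (K : nat -> hilbertType R).
Variables (C : forall n, {linear K n.+1 -> K n}) (C1 : forall n, contraction (C n)).

Lemma hnorm_thread (x : inverse_limit C1) : hnorm x = thread_norm x.
Proof. by []. Qed.

Definition lim_proj n (x : inverse_limit C1) : K n := x n.

Lemma lim_proj_linear n : linear (@lim_proj n).
Proof. by move=> a x y; rewrite /lim_proj thread_addE thread_scaleE. Qed.

HB.instance Definition _ n :=
  GRing.isLinear.Build _ _ _ _ (@lim_proj n) (@lim_proj_linear n).

Lemma lim_proj_contraction n : contraction (@lim_proj n).
Proof. by move=> x; rewrite le_hnorm hnorm_thread_le. Qed.

(** The universal property of the inverse limit among contractions. *)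
Lemma lim_universal (V : hilbertType R) (f : forall n, {linear V -> K n}) :
  (forall n, contraction (f n)) -> (forall n x, C n (f n.+1 x) = f n x) ->
  exists J : {linear V -> inverse_limit C1},
    contraction J /\ forall x n, J x n = f n x.
Proof.
move=> f1 Cf.
have fP x : is_thread C (fun n => f n x).
  by split=> // ; exists (hnorm x) => n; exact: contraction_hnorm.
pose J x := Thread C1 (fP x).
have J_linear : linear J.
  move=> a x y; apply: thread_eq => n.
  by rewrite thread_addE thread_scaleE /= linearP.
pose J' : {linear V -> inverse_limit C1} :=
  HB.pack J (GRing.isLinear.Build _ _ _ _ J J_linear).
exists J'; split => // x.
rewrite le_hnorm hnorm_thread; apply: thread_norm_le => n.
exact: contraction_hnorm.
Qed.

End Universal.

(** * Limits of increasing sequences of operators *)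

Lemma ereal_sup_lty (R : realType) (u : nat -> R) :
  (ereal_sup (range (fun n => (u n)%:E)) < +oo)%E <-> exists M, forall n, u n <= M.
Proof.
split=> [u_lty|[M uM]]; last first.
  apply: (@le_lt_trans _ _ M%:E); last exact: ltry.
  by apply: ge_ereal_sup => _ [n _ <-]; rewrite lee_fin.
have ub n : ((u n)%:E <= ereal_sup (range (fun n => (u n)%:E)))%E.
  by apply: ereal_sup_ubound; exists n.
exists (fine (ereal_sup (range (fun n => (u n)%:E)))) => n.
rewrite -lee_fin fineK// fin_numElt u_lty andbT.
by apply: lt_le_trans (ub 0%N); exact: ltNyr.
Qed.

Theorem proposition6p1 (R : realType) (H : hilbertType R)
    (Kn : nat -> hilbertType R) (Tn : forall n, set (H * Kn n))
    (Tn_operator : forall n, linear_operator (Tn n))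
    (Tn_prec : forall m n, (m <= n)%N -> Tn m \prec_c Tn n)
    (Tn_closable : forall n, closable (Tn n))
    (K : hilbertType R) (T : set (H * K))
    (T_operator : linear_operator T) (T_closable : closable T)
    (T_dom : dom T = bounded_dom Tn)
    (Tn_prec_T : forall n, Tn n \prec_c T)
    (Tn_nearrow_T : forall x, dom T x -> norm_nearrow Tn T x) :
  (forall m n, (m <= n)%N -> biadjoint (Tn m) \prec_c biadjoint (Tn n)) /\
  (forall n, biadjoint (Tn n) \prec_c biadjoint T) /\
  exists (Kc : hilbertType R) (S : set (H * Kc)),
    linear_operator S /\
    closed_relation S /\
    dom S = bounded_dom (fun n => biadjoint (Tn n)) /\
    (forall n, biadjoint (Tn n) \prec_c S) /\
    S \prec_c biadjoint T /\
    (forall x, dom S x -> norm_nearrow (fun n => biadjoint (Tn n)) S x) /\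
    dom (biadjoint T) `<=` dom S /\
    (forall x, dom (biadjoint T) x ->
       hnorm (app S x) = hnorm (app (biadjoint T) x)).
Proof.
split; first by move=> m n /Tn_prec; exact: contr_dominated_biadjoint.
split; first by move=> n; exact: contr_dominated_biadjoint.
pose C n := sval (cid (Tn_prec n n.+1 (leqnSn n))).
have C1 n : contraction (C n).
  by have [] := svalP (cid (Tn_prec n n.+1 (leqnSn n))).
have CTn n : [set (f.1, C n f.2) | f in Tn n.+1] `<=` Tn n.
  by have [] := svalP (cid (Tn_prec n n.+1 (leqnSn n))).
pose D n := sval (cid (Tn_prec_T n)).
have D1 n : contraction (D n) by have [] := svalP (cid (Tn_prec_T n)).
have DT n : [set (f.1, D n f.2) | f in T] `<=` Tn n.
  by have [] := svalP (cid (Tn_prec_T n)).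
pose N : set K := snd @` T.
have T_rel : linear_relation T by case: T_operator.
have N_submod : submod_closed [in N] := ran_submod T_rel.
have [P [P1 PN PK]] := orthogonal_projection N_submod.
pose Kc : hilbertType R := inverse_limit C1.
pose S : set (H * Kc) :=
  [set p | forall n, biadjoint (Tn n) (p.1, (p.2 : inverse_limit C1) n)].
have S_op : linear_operator S.
  split.
    apply/submod_setP; split => [n|a x y Sx Sy n].
      by have /submod_setP[] := biadjoint_submod (Tn n).
    have /submod_setP[_ TZ] := biadjoint_submod (Tn n).
    have -> : ((a *: x + y).2 : inverse_limit C1) n =
        a *: (x.2 : inverse_limit C1) n + (y.2 : inverse_limit C1) n.
      by rewrite thread_addE thread_scaleE.
    exact: TZ a _ _ (Sx n) (Sy n).
  apply/seteqP; split => [k Sk|_ ->] /=.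
    apply: thread_eq => n; have [_ T0] := Tn_closable n.
    suff : Defs.mul (biadjoint (Tn n)) ((k : inverse_limit C1) n) by rewrite T0.
    exact: Sk n.
  by move=> n; have /submod_setP[T0 _] := biadjoint_submod (Tn n); exact: T0.
have SP x k : S (x, k) -> forall n, app (biadjoint (Tn n)) x = k n.
  by move=> Sxk n; apply: appE (Tn_closable n) (Sxk n).
have projS n : [set (f.1, lim_proj n f.2) | f in S] `<=` biadjoint (Tn n).
  by move=> _ [f Sf <-]; exact: Sf.
(* (x, k) in the closure of S projects to (x, k n) in the closure of the closed
   relation A_n *)
have S_closed : closed_relation S.
  apply/seteqP; split; first exact: sub_biadjoint.
  move=> f Sf n; rewrite biadjoint_closed.
  apply: (biadjoint_contraction (@lim_proj_contraction _ _ _ C1 n) (projS n)).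
  by exists f.
have S_dom : dom S = bounded_dom (fun n => biadjoint (Tn n)).
  apply/seteqP; split => [x /domP[k Sxk]|x [Tx /ereal_sup_lty xM]].
    split; first by move=> n _; apply/domP; exists (k n); exact: Sxk.
    apply/ereal_sup_lty; have [_ [M kM]] := threadP k.
    by exists M => n; rewrite (SP _ _ Sxk).
  have Tapp n : biadjoint (Tn n) (x, app (biadjoint (Tn n)) x).
    exact: app_dom (Tn_closable n) (Tx n I).
  have thread_x : is_thread C (fun n => app (biadjoint (Tn n)) x).
    split=> // n; apply/esym/(appE (Tn_closable n)).
    apply: (biadjoint_contraction (C1 n) (CTn n)).
    by exists (x, app (biadjoint (Tn n.+1)) x).
  by apply/domP; exists (Thread C1 thread_x).
have [J [J1 JE]] : exists J : {linear K -> Kc}, contraction J /\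
    forall k n, (J k : inverse_limit C1) n = D n (P k).
  apply: (@lim_universal _ _ _ C1 K (fun n => D n \o P)) => [n x|n k /=].
    by rewrite /= (le_trans (D1 _ _)).
  pose CD : {linear K -> Kn n} := C n \o D n.+1.
  apply: (@contraction_eq_closure _ _ _ N CD (D n)) (PN k) => // [y|].
    exact: le_trans (C1 _ _) (D1 _ _).
  (* on ran T both maps give the value of the operator T n *)
  move=> _ [[x m] /= Txm <-].
  have DTxm i : Tn i (x, D i m) by apply: DT; exists (x, m).
  apply: (operator_unique (Tn_operator n) _ (DTxm n)).
  by apply: CTn; exists (x, D n.+1 m).
have JS f : biadjoint T f -> S (f.1, J f.2).
  move=> Tf n /=; rewrite JE PK; last exact: ran_biadjoint T_rel Tf.
  by apply: (biadjoint_contraction (D1 n) (DT n)); exists f.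
(* |J (T x)| and |T x| are both the limit of |T_n x| *)
have J_isom_ran k : N k -> hnorm (J k) = hnorm k.
  move=> Nk; case: (Nk) => -[x k'] /= Txk kE; subst k'.
  have [_] := Tn_nearrow_T x ltac:(by apply/domP; exists k).
  rewrite (appE T_operator Txk) => Tk.
  apply: esym; apply: (cvg_seq_unique Tk).
  rewrite (_ : (fun n => _) = fun n => hnorm ((J k : inverse_limit C1) n)).
    exact: thread_cvg.
  apply/funext => n; rewrite JE PK; last exact: subset_closure.
  by rewrite (@appE _ _ _ (Tn n) x (D n k))//; apply: DT; exists (x, k).
have J_isom := contraction_isometry_closure J1 J_isom_ran.
exists Kc, S; do 3!split => //.
split.
  move=> n; exists (lim_proj n).
  by split; [exact: lim_proj_contraction|exact: projS].
split; first by exists J; split => // _ [f Tf <-]; exact: JS.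
split.
  move=> x /domP[k Sxk].
  rewrite /norm_nearrow (appE S_op Sxk).
  rewrite (_ : (fun n => hnorm _) = fun n => hnorm (k n)); last first.
    by apply/funext => n; rewrite (SP _ _ Sxk).
  by split; [exact: thread_nondecreasing|exact: thread_cvg].
have Tapp x : dom (biadjoint T) x -> biadjoint T (x, app (biadjoint T) x).
  exact: app_dom.
split=> x /Tapp Tx; have SJ := JS _ Tx.
  by apply/domP; eexists; exact: SJ.
rewrite (appE S_op SJ) J_isom//.
exact: ran_biadjoint T_rel Tx.
Qed.
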